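(* Consider the symmetric moment problem given by an eventually $q$-increasing sequence $(b_n)_{n\ge0}$ of positive numbers. Then (i) $(U_n)$, $(V_n)$ and $\big(c_n\sqrt{s_{2n}}\big)$ are bounded sequences; (ii) property (cs* ) holds, i.e. $\sum_{l=0}^\infty c_l|s_{l+m}|<\infty$ for all $m\ge0$.
   Context: Given positive numbers $(b_n)_{n\ge0}$, let $P_{-1}=0$, $P_0=1$ and $xP_n(x)=b_nP_{n+1}(x)+b_{n-1}P_{n-1}(x)$, $n\ge0$ (the value of $b_{-1}$ is irrelevant). There is a probability measure $\mu$ on $\mathbb{R}$ with infinite support and all moments for which $(P_n)$ are the orthonormal polynomials; its moments $s_n=\int x^n\,d\mu$ depend only on $(b_n)$ (and $s_n=0$ for $n$ odd). The associated Hamburger moment problem is the symmetric moment problem given by $(b_n)$; it is indeterminate if more than one measure has the moments $(s_n)$. Eventually $q$-increasing: there exist $0<q<1$ and $n_0\in\mathbb{N}$ such that $b_{n-1}/b_n\le q$ for all $n\ge n_0$. (The moment problem is then indeterminate.) Write $P_n(x)=\sum_{k=0}^n b_{k,n}x^k$. In the indeterminate case put $c_k=\big(\sum_{n=k}^\infty b_{k,n}^2\big)^{1/2}<\infty$. Define $U_0=s_0=1$, $V_0=c_0$ and for $n\ge1$ $$U_n=\frac{s_{2n}}{b_0^2b_1^2\cdots b_{n-1}^2},\qquad V_n=b_0b_1\cdots b_{n-1}\,c_n .$$ *)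

(* Defs.v *)
From HB Require Import structures.
From mathcomp Require Import all_boot all_order all_algebra.
From mathcomp Require Import all_classical all_reals all_analysis.

Set Implicit Arguments.
Unset Strict Implicit.
Unset Printing Implicit Defensive.

Import Order.TTheory GRing.Theory Num.Theory.
Import numFieldNormedType.Exports.

Local Open Scope ring_scope.

Section SymmetricMomentProblem.
Context {R : realType}.
Implicit Types (b : nat -> R) (mu : probability (measurableTypeR R) R).

(* The index is shifted by one, so that the irrelevant b_(-1) never occurs. *)
Definition eventually_q_increasing b : Prop :=
  exists q : R, exists n0 : nat,
    0 < q < 1 /\ forall n : nat, (n0 <= n.+1)%N -> b n / b n.+1 <= q.

Fixpoint opoly b (n : nat) : {poly R} :=
  match n with
  | 0 => 1
  | k.+1 => (b k)^-1 *: ('X * opoly b k -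
      match k with
      | 0 => 0
      | j.+1 => b j *: opoly b j
      end)
  end.

Lemma mulX_opoly0 b : b 0%N != 0 -> 'X * opoly b 0 = b 0%N *: opoly b 1.
Proof. by move=> b0; rewrite /= subr0 scalerA divff// scale1r. Qed.

Lemma mulX_opolyS b (n : nat) : b n.+1 != 0 ->
  'X * opoly b n.+1 = b n.+1 *: opoly b n.+2 + b n *: opoly b n.
Proof.
move=> bn; rewrite [opoly b n.+2]/= -/(opoly b n.+1).
by rewrite scalerA divff// scale1r subrK.
Qed.

Definition moment mu (n : nat) : R := (\int[mu]_x (x ^+ n))%R.

(* Orthonormality for all degrees forces mu to have infinite support: otherwise
   some nonzero polynomial has L2(mu)-norm zero. *)
Definition solves_moment_problem b mu : Prop :=
  (forall n : nat, mu.-integrable [set: R] (fun x => (x ^+ n)%:E)) /\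
  (forall m n : nat,
     (\int[mu]_x ((opoly b m).[x] * (opoly b n).[x]))%R = (m == n)%:R).

(* Extended real valued, so that a divergent series gives +oo; in particular
   boundedness of [V] below entails that every [c b k] is finite. *)
Definition c b (k : nat) : \bar R :=
  sqrte (\sum_(k <= n <oo) (((opoly b n)`_k) ^+ 2)%:E)%E.

Definition U b mu (n : nat) : R :=
  moment mu n.*2 / \prod_(i < n) b i ^+ 2.

Definition V b (n : nat) : \bar R := ((\prod_(i < n) b i)%:E * c b n)%E.

Definition ebounded (u : nat -> \bar R) : Prop :=
  exists M : R, forall n, (`|u n| <= M%:E)%E.

Definition cs_star b mu : Prop :=
  forall m : nat,
    (\sum_(0 <= l <oo) (c b l * `|moment mu (l + m)|%:E) < +oo)%E.

End SymmetricMomentProblem.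

(* Main.v *)
Require Import Defs.
From HB Require Import structures.
From mathcomp Require Import all_boot all_order all_algebra.
From mathcomp Require Import all_classical all_reals all_analysis.
From mathcomp Require Import ring lra zify.

Import Order.TTheory GRing.Theory Num.Theory.
Import numFieldNormedType.Exports.

Local Open Scope ring_scope.

(* The coefficients of P_n in the monomial basis and of x^n in the orthonormal
   basis, normalized by products of the b_i, both satisfy a two-term recurrence
   in which the entry at distance j + 2 from the diagonal is at most
   a * (previous entry at distance j + 2) + q * (an entry at distance j), where
   a <= min(q, C q^j) except for finitely many entries.  Such an array decays
   geometrically away from the diagonal, uniformly along it.  Squaring and
   summing over the distance bounds V_n, respectively U_n, because s_(2n) is
   the squared norm of x^n.  For (cs-star), write l = m + 2t; then
   c_l s_(l+m) is at most a constant times (b_0 ... b_(m+t-1))^2 / (b_0 ...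
   b_(m+2t-1)), which is O((C q^t)^t). *)

(** * Recursive inequalities for sequences and arrays, and the growth of [b] *)

Section RealSequences.
Context {R : realType}.
Implicit Types (q r C e M : R) (x b : nat -> R).

Lemma geometric_eventually_le q C e : 0 < q < 1 -> 0 < e ->
  exists N : nat, forall n, (N <= n)%N -> C * q ^+ n <= e.
Proof.
move=> /andP[q0 q1] e0.
have qn : `|q| < 1 by rewrite gtr0_norm.
have /cvgr0_norm_le/(_ _ e0)[N _ HN] := cvg_geometric C qn.
by exists N => n Nn; rewrite (le_trans (ler_norm _))//; exact: (HN n Nn).
Qed.

Lemma sum_geometric_le r n : 0 <= r < 1 -> \sum_(i < n) r ^+ i <= (1 - r)^-1.
Proof.
move=> /andP[r0 r1]; rewrite -[leRHS]mul1r ler_pdivlMr ?subr_gt0//.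
have := subrX1 r n; have := exprn_ge0 n r0; move: (\sum_(i < n) _) => S; nra.
Qed.

Lemma bounded_prefix x N : exists M, 0 <= M /\ forall n, (n < N)%N -> x n <= M.
Proof.
exists (\sum_(i < N) `|x i|); split; first exact: sumr_ge0.
move=> n nN; rewrite (bigD1 (Ordinal nN))//=.
by rewrite (le_trans (ler_norm _))// lerDl sumr_ge0.
Qed.

(** With [M] bounding the terms up to index [N], the ceiling [M + D] is invariant, because [D] is
    the fixed point of x -> q x + |C|. *)
Lemma contraction_bounded x q C N : 0 < q < 1 ->
  (forall k, (N <= k)%N -> x k.+1 <= q * x k + C) ->
  exists M, forall k, x k <= M.
Proof.
move=> /andP[q0 q1] H; have [M [M0 HM]] := bounded_prefix x N.+1.
have Cq : `|C| / (1 - q) * (1 - q) = `|C| by rewrite divfK// subr_eq0 gt_eqF.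
set D := `|C| / (1 - q) in Cq.
have D0 : 0 <= D by rewrite divr_ge0// subr_ge0 ltW.
exists (M + D); elim=> [|k IH].
  by rewrite (le_trans (HM 0%N isT))// lerDl.
have [kN|Nk] := ltnP k N; first by rewrite (le_trans (HM _ _))// lerDl.
apply: (le_trans (H _ Nk)).
have := ler_norm C; nra.
Qed.

(* [u k j] stands for the entry in column [k] at distance [j] from the diagonal,
   i.e. of degree [k + j]. *)
Definition array_recurrence (u : nat -> nat -> R) q C N :=
  [/\ forall k j, 0 <= u k j,
      forall j, (N <= j)%N -> exists k', u 0%N j.+2 <= q * u k' j &
      forall k j, (N <= k + j)%N -> exists a k',
        [/\ 0 <= a, a <= q, a <= C * q ^+ j &
            u k.+1 j.+2 <= a * u k j.+2 + q * u k' j]].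

(** Induction in steps of two: a bound [M] at distance [j] makes the entries at distance [j + 2]
    satisfy x_(k+1) <= q x_k + q M from [N] on. The resulting bound may still depend on [j]. *)
Lemma array_bounded_column u q C N j : 0 < q < 1 -> array_recurrence u q C N ->
  (forall k, u k 0%N <= 1) -> (forall k, u k 1%N <= 1) ->
  exists M, forall k, u k j <= M.
Proof.
move=> q01 [u0 _ uS] H0 H1; have /andP[q0 q1] := q01.
suff: (exists M, forall k, u k j <= M) /\ (exists M, forall k, u k j.+1 <= M).
  by case.
elim: j => [|j [[M HM] HS]]; first by split; exists 1.
split=> //.
apply: (@contraction_bounded (u ^~ j.+2) q (q * M) N) => // k Nk.
have [|a [k' [a0 aq _ le]]] := uS k j; first exact: leq_trans Nk (leq_addr _ _).
apply: (le_trans le); have := u0 k j.+2; have := HM k'; nra.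
Qed.

(* For large [j] the coefficient [a] is negligible, so that the factor [q]
   gained on passing from [j] to [j + 2] permits any rate [r] with [q < r ^ 2]. *)
Lemma array_geometric_bound u q C N : 0 < q < 1 -> array_recurrence u q C N ->
  (forall k, u k 0%N <= 1) -> (forall k, u k 1%N <= 1) ->
  exists K r, [/\ 0 <= K, 0 < r < 1 & forall k j, u k j <= K * r ^+ j].
Proof.
move=> q01 Hu H0 H1; have /andP[q0 q1] := q01.
have [u0 u0S uS] := Hu.
(* With this choice r^2 - q = (1 - q)^2 / 4 > 0. *)
pose r := (1 + q) / 2.
have r0 : 0 < r by rewrite /r; lra.
have r1 : r < 1 by rewrite /r; lra.
have rq : q < r ^+ 2 by rewrite /r; nra.
(* From [J] on, a <= C q^j <= 1 - q / r^2, that is, a + q / r^2 <= 1. *)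
have [J HJ] := @geometric_eventually_le q C (1 - q / r ^+ 2) q01
  ltac:(by rewrite subr_gt0 ltr_pdivrMr ?mul1r ?exprn_gt0).
pose L := (maxn N J).+2.
(* Only finitely many distances lie below [L]; there [K] absorbs the bounds, uniform in [k], divided
   by r^j. *)
have [K [K0 HK]] : exists K, 0 <= K /\
    forall j, (j < L)%N -> forall k, u k j <= K * r ^+ j.
  have /choice[M HM] := fun j => @array_bounded_column u q C N j q01 Hu H0 H1.
  have [K [K0 HK]] := bounded_prefix (fun j => M j / r ^+ j) L.
  exists K; split=> // j jL k; apply: (le_trans (HM j k)).
  by rewrite -ler_pdivrMr ?exprn_gt0// HK.
exists K, r; split=> //; first by rewrite r0.
move=> k j; elim/ltn_ind: j k => j IH.
have [jL|Lj] := ltnP j L; first exact: HK.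
case: j => [//|[//|j]] in IH Lj *.
have /andP[Nj Jj] : (N <= j)%N && (J <= j)%N by rewrite -geq_max -2!ltnS.
have IHj k : u k j <= K * r ^+ j by exact: IH.
have E : r ^+ j = r ^+ j.+2 / r ^+ 2.
  by rewrite -addn2 exprD mulfK// expf_neq0 ?gt_eqF.
have qE : q * (K * r ^+ j) = (q / r ^+ 2) * (K * r ^+ j.+2) by rewrite E; ring.
have X0 : 0 <= K * r ^+ j.+2 by rewrite mulr_ge0// exprn_ge0 ?ltW.
(* Distance [j] is already known in every column; along the columns [K] is preserved, since (a + q /
   r^2) K r^(j+2) <= K r^(j+2). *)
elim=> [|k IHk].
  have [k' le] := u0S _ Nj; apply: (le_trans le).
  apply: (@le_trans _ _ (q * (K * r ^+ j))); first by rewrite ler_pM2l.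
  by rewrite qE ler_piMl// ler_pdivrMr ?exprn_gt0// mul1r ltW.
have [|a [k' [a0 aq aC le]]] := uS k j; first exact: leq_trans Nj (leq_addl _ _).
apply: (le_trans le).
apply: (@le_trans _ _ (a * (K * r ^+ j.+2) + q * (K * r ^+ j))).
  by rewrite lerD ?ler_wpM2l// ltW.
rewrite qE -mulrDl ler_piMl//.
by rewrite -lerBrDr (le_trans aC)// HJ.
Qed.

(** Induction on [N], dropping the first term. In the new constant, 1 serves k = n = 0, [C] serves
    the shifted sequence, and the last summand compares [x 0] with later terms through [x 1]. *)
Lemma eventually_nondecreasing_quasi x N : (forall n, 0 < x n) ->
  (forall n, (N <= n)%N -> x n <= x n.+1) ->
  exists C, 0 < C /\ forall k n, (k <= n)%N -> x k <= C * x n.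
Proof.
elim: N x => [|N IH] x x0 xS.
  exists 1; split=> // k n kn; rewrite mul1r.
  by apply: (@homo_leq _ x (fun u v => u <= v)) => //;
    [exact: le_trans|move=> i; exact: xS].
have [|n Nn|C [C0 HC]] := IH (fun n => x n.+1); [by []|exact: xS|].
have D0 : 0 <= x 0%N / x 1%N by rewrite divr_ge0// ltW.
have DC0 := mulr_ge0 D0 (ltW C0).
exists (1 + C + x 0%N / x 1%N * C); split; first by lra.
move=> [|k] [|n]//.
- by have := x0 0%N; nra.
- move=> _; have := HC 0%N n isT; have := x0 n.+1.
  have : x 0%N / x 1%N * x 1%N = x 0%N by rewrite divfK// gt_eqF.
  move: (x 0%N / x 1%N) D0 => d d0 <- ? ?; nra.
- by rewrite ltnS => kn; have := HC _ _ kn; have := x0 n.+1; nra.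
Qed.

(** The sequence b_n q^n is eventually nondecreasing; its monotonicity up to a constant is the bound
    C q^(n-k). *)
Lemma q_increasing_decay b : (forall n, 0 < b n) -> eventually_q_increasing b ->
  exists q C N, [/\ 0 < q < 1, 0 < C,
    forall k n, (k <= n)%N -> b k / b n <= C * q ^+ (n - k) &
    forall k n, (N <= n)%N -> (k < n)%N -> b k / b n <= q].
Proof.
move=> b0 [q [n0 [q01 bq]]]; have /andP[q0 q1] := q01.
have bS n : (n0 <= n)%N -> b n <= q * b n.+1.
  by move=> n0n; rewrite -ler_pdivrMr// bq// leqW.
have [||C [C0 HC]] := @eventually_nondecreasing_quasi (fun n => b n * q ^+ n) n0.
- by move=> n; rewrite mulr_gt0// exprn_gt0.
- move=> n n0n; rewrite exprS mulrA ler_pM2r ?exprn_gt0//.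
  by rewrite mulrC bS.
have decay k n : (k <= n)%N -> b k / b n <= C * q ^+ (n - k).
  move=> kn; rewrite ler_pdivrMr// -(@ler_pM2r _ (q ^+ k)) ?exprn_gt0//.
  suff -> : C * q ^+ (n - k) * b n * q ^+ k = C * (b n * q ^+ n) by exact: HC.
  have -> : q ^+ n = q ^+ (n - k) * q ^+ k by rewrite -exprD subnK.
  by ring.
have [N HN] := @geometric_eventually_le q C q q01 q0.
(* If k >= n0, then b_k / b_n <= b_k / b_(k+1) <= q; otherwise n - k > N and C q^(n-k) <= q. *)
exists q, C, (n0 + N)%N; split=> // k n Nn kn.
have [n0k|kn0] := leqP n0 k.
  apply: le_trans (_ : b k / b k.+1 <= q); last exact/bq/leqW.
  rewrite ler_pM2l// lef_pV2 ?posrE// -(subnKC kn).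
  elim: (n - k.+1)%N => [|m IH]; first by rewrite addn0.
  rewrite addnS (le_trans IH)//; apply: (le_trans (bS _ _)); first by lia.
  by rewrite ler_piMl ?ltW.
by apply: le_trans (HN (n - k)%N _); [exact: decay (ltnW kn)|lia].
Qed.

End RealSequences.

(** * Coefficients of the orthonormal polynomials and of the monomials *)

Section OrthogonalPolynomials.
Context {R : realType}.
Variable b : nat -> R.
Hypothesis b_gt0 : forall n, 0 < b n.

Definition bprod n := \prod_(i < n) b i.

Lemma bprodS n : bprod n.+1 = bprod n * b n.
Proof. exact: big_ord_recr. Qed.

Lemma bprod_gt0 n : 0 < bprod n.
Proof. exact: prodr_gt0. Qed.

Lemma coef_opolyS0 n :
  (opoly b n.+2)`_0 = - (b n / b n.+1) * (opoly b n)`_0.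
Proof.
rewrite [opoly b n.+2]/= -/(opoly b n.+1) coefZ coefB coefZ coefXM/=.
by rewrite sub0r; ring.
Qed.

Lemma coef_opolySS k n :
  (opoly b n.+2)`_k.+1 =
  (opoly b n.+1)`_k / b n.+1 - b n / b n.+1 * (opoly b n)`_k.+1.
Proof.
rewrite [opoly b n.+2]/= -/(opoly b n.+1) coefZ coefB coefZ coefXM/=.
by ring.
Qed.

Lemma coef_opoly1 k : (opoly b 1)`_k = (k == 1%N)%:R / b 0%N.
Proof. by rewrite /= subr0 mulr1 coefZ coefX mulrC. Qed.

Lemma coef_opoly_gt n k : (n < k)%N -> (opoly b n)`_k = 0.
Proof.
suff : (forall k, (n < k)%N -> (opoly b n)`_k = 0) /\
       (forall k, (n.+1 < k)%N -> (opoly b n.+1)`_k = 0) by case=> + _; apply.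
elim: n {k} => [|n [IH IHS]].
  split=> -[|k]//; first by rewrite coef1.
  by rewrite coef_opoly1 => /gtn_eqF ->; rewrite mul0r.
split=> // -[//|k] nk.
by rewrite coef_opolySS IHS// IH ?mulr0 ?mul0r ?subr0// ltnW// ltnW.
Qed.

(** The factor [bprod k] is the inverse of the leading coefficient of P_k, so the diagonal becomes 1
    and the squares in column [k] sum to V_k^2. *)
Definition opoly_array k j := bprod k * `|(opoly b (k + j))`_k|.

Lemma opoly_array0 k : opoly_array k 0 = 1.
Proof.
rewrite /opoly_array addn0.
suff -> : (opoly b k)`_k = (bprod k)^-1.
  by rewrite gtr0_norm ?invr_gt0 ?bprod_gt0// divff// gt_eqF ?bprod_gt0.
elim: k => [|[|k] IH]; first by rewrite coef1 /bprod big_ord0 invr1.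
  by rewrite coef_opoly1 bprodS /bprod big_ord0 !mul1r.
by rewrite coef_opolySS IH (@coef_opoly_gt k)// mulr0 subr0 [in RHS]bprodS invfM.
Qed.

Lemma opoly_array1 k : opoly_array k 1 = 0.
Proof.
rewrite /opoly_array addn1.
suff -> : (opoly b k.+1)`_k = 0 by rewrite normr0 mulr0.
elim: k => [|k IH]; first by rewrite coef_opoly1 mul0r.
by rewrite coef_opolySS IH (@coef_opoly_gt k)// mulr0 subr0 mul0r.
Qed.

(* The coefficients of [x ^ n] in the orthonormal basis. *)
Fixpoint beta (n k : nat) : R :=
  match n with
  | 0 => (k == 0%N)%:R
  | m.+1 => (if k is l.+1 then b l * beta m l else 0) + b k * beta m k.+1
  end.

Lemma betaS0 n : beta n.+1 0 = b 0%N * beta n 1.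
Proof. exact: add0r. Qed.

Lemma betaSS n k : beta n.+1 k.+1 = b k * beta n k + b k.+1 * beta n k.+2.
Proof. by []. Qed.

Lemma beta_gt n k : (n < k)%N -> beta n k = 0.
Proof.
elim: n k => [|n IH] [|k]//= nk.
by rewrite !IH ?mulr0 ?addr0//; lia.
Qed.

Lemma beta_odd n k : odd (n + k) -> beta n k = 0.
Proof.
elim: n k => [|n IH] [|k]//= nk.
  by rewrite IH ?mulr0 ?addr0//; lia.
by rewrite !IH ?mulr0 ?addr0//; lia.
Qed.

Lemma beta_ge0 n k : 0 <= beta n k.
Proof.
elim: n k => [|n IH] [|k]//=.
  by rewrite add0r mulr_ge0// ltW.
by rewrite addr_ge0// mulr_ge0// ltW.
Qed.

(** Multiplication by X acts through the three-term recurrence, which is the recursion defining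
    [beta]. *)
Lemma Xn_opolyE n : 'X^n = \sum_(k < n.+1) beta n k *: opoly b k.
Proof.
elim: n => [|n IH]; first by rewrite big_ord1 scale1r expr0.
have b_neq0 k : b k != 0 by rewrite gt_eqF.
have XP k : 'X * opoly b k =
    b k *: opoly b k.+1 + (if k is l.+1 then b l *: opoly b l else 0).
  by case: k => [|k]; rewrite ?mulX_opolyS// addr0 mulX_opoly0.
rewrite exprS {}IH mulr_sumr.
under eq_bigr do rewrite -scalerAr XP scalerDr.
under [RHS]eq_bigr do rewrite /= scalerDl.
rewrite !big_split/=; congr (_ + _).
  rewrite [RHS]big_ord_recl/= scale0r add0r.
  by apply: eq_bigr => k _; rewrite scalerA mulrC.
(* In the lowering part the left sum loses its term k = 0, and the right sum its last two terms,
   where [beta] vanishes. *)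
rewrite big_ord_recl/= scaler0 add0r !big_ord_recr/= !beta_gt// !mulr0 !scale0r !addr0.
by apply: eq_bigr => k _; rewrite scalerA mulrC.
Qed.

(** With n = k + j, the divisor is the diagonal coefficient [beta n n]; the squares on the
    antidiagonal k + j = n sum to U_n. *)
Definition beta_array k j := beta (k + j) k / bprod (k + j).

Lemma beta_array0 k : beta_array k 0 = 1.
Proof.
rewrite /beta_array addn0.
suff -> : beta k k = bprod k by rewrite divff// gt_eqF ?bprod_gt0.
elim: k => [|k IH]/=; first by rewrite /bprod big_ord0.
by rewrite IH beta_gt// mulr0 addr0 bprodS mulrC.
Qed.

Lemma beta_array1 k : beta_array k 1 = 0.
Proof. by rewrite /beta_array beta_odd ?mul0r//; lia. Qed.

(** * Recurrences of the two arrays *)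

Section Decay.
Variables (q C : R) (N : nat).
Hypothesis q01 : 0 < q < 1.
Hypothesis C_gt0 : 0 < C.
Hypothesis decay : forall k n, (k <= n)%N -> b k / b n <= C * q ^+ (n - k).
Hypothesis ratio_le : forall k n, (N <= n)%N -> (k < n)%N -> b k / b n <= q.

Lemma ratio_decay k j : b k / b (k + j.+2) <= C * q ^+ j.
Proof.
have /andP[q0 q1] := q01.
have := decay k (k + j.+2) (leq_addr _ _); rewrite addKn => /le_trans; apply.
by rewrite ler_pM2l// ler_wiXn2l ?ltW ?leqW.
Qed.

(** The recurrence for the coefficient of x^(k+1) in P_(k+j+3), times [bprod k.+1], gives a = b_k /
    b_(k+j+2). For constant terms only the second summand is present. *)
Lemma opoly_array_recurrence : array_recurrence opoly_array q C N.
Proof.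
have r0 k n : 0 <= b k / b n by rewrite divr_ge0// ltW.
have u0 k j : 0 <= opoly_array k j by rewrite mulr_ge0// ltW// bprod_gt0.
split; [exact: u0|move=> j Nj|move=> k j Nkj].
  exists 0%N; rewrite /opoly_array !add0n coef_opolyS0 normrM normrN (ger0_norm (r0 _ _)).
  rewrite mulrCA; apply: ler_wpM2r; first exact: (u0 0%N j).
  by apply: ratio_le; lia.
exists (b k / b (k + j.+2)), k.+1; split=> //.
- by apply: ratio_le; lia.
- exact: ratio_decay.
rewrite {1}/opoly_array !(addnS, addSn) coef_opolySS.
rewrite {1 2}/opoly_array -/(bprod k.+1) !(addnS, addSn) bprodS.
have bk := ltW (b_gt0 k); have Pk := ltW (bprod_gt0 k).
apply: (@le_trans _ _ (bprod k * b k *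
    (`|(opoly b (k + j).+2)`_k| / b (k + j).+2 +
     q * `|(opoly b (k + j).+1)`_k.+1|))); last first.
  by rewrite mulrDr lerD// le_eqVlt; apply/orP; left; apply/eqP; ring.
rewrite ler_wpM2l ?mulr_ge0// (le_trans (ler_normB _ _))// !normrM.
rewrite normfV !(gtr0_norm (b_gt0 _)) lerD2l ler_wpM2r//.
by apply: ratio_le; lia.
Qed.

(** Divide [betaSS] for x^(k+j+3) by [bprod (k + j + 3)]. The second summand lies in column k + 2,
    with factor b_(k+1) / b_(k+j+2) <= q. *)
Lemma beta_array_recurrence : array_recurrence beta_array q C N.
Proof.
have r0 k n : 0 <= b k / b n by rewrite divr_ge0// ltW.
have u0 k j : 0 <= beta_array k j.
  by rewrite divr_ge0 ?beta_ge0// ltW// bprod_gt0.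
have P0 n : bprod n != 0 by rewrite gt_eqF ?bprod_gt0.
have b0 n : b n != 0 by rewrite gt_eqF.
split; [exact: u0|move=> j Nj|move=> k j Nkj].
  exists 1%N; apply: (@le_trans _ _ (b 0%N / b j.+1 * beta_array 1 j)).
    by rewrite /beta_array add0n add1n betaS0 bprodS (mulrC (bprod _)) invfM mulrACA.
  by apply: ler_wpM2r; [exact: u0|apply: ratio_le; lia].
exists (b k / b (k + j.+2)), k.+2; split=> //.
- by apply: ratio_le; lia.
- exact: ratio_decay.
apply: (@le_trans _ _ (b k / b (k + j.+2)%N * beta_array k j.+2 +
                       b k.+1 / b (k + j.+2)%N * beta_array k.+2 j)).
  rewrite /beta_array !(addnS, addSn) betaSS (bprodS (k + j).+2) invfM.
  by rewrite le_eqVlt; apply/orP; left; apply/eqP; ring.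
by rewrite lerD2l; apply: ler_wpM2r; [exact: u0|apply: ratio_le; lia].
Qed.

End Decay.

End OrthogonalPolynomials.

(** * Moments as integrals of polynomials *)

Section Moments.
Context {R : realType}.
Variables (b : nat -> R) (mu : probability (measurableTypeR R) R).
Hypothesis b_gt0 : forall n, 0 < b n.
Hypothesis mu_sol : solves_moment_problem b mu.
Implicit Types p : {poly R}.

Lemma integrable_horner p :
  mu.-integrable [set: R] (EFin \o (fun x : R => p.[x])).
Proof.
have [integrable_Xn _] := mu_sol.
have -> : EFin \o (fun x : R => p.[x]) =
    (fun x : R => \sum_(i < size p) ((p`_i)%:E * (x ^+ i)%:E))%E.
  by apply/funext => x /=; rewrite horner_coef -sumEFin.
apply: integrable_sum => // i _.
exact: integrableZl.
Qed.

Definition polyint p : R := (\int[mu]_x p.[x])%R.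

Lemma polyintD p p' : polyint (p + p') = polyint p + polyint p'.
Proof.
rewrite /polyint -RintegralD//; [|exact: integrable_horner..].
by apply: eq_Rintegral => x _; rewrite hornerD.
Qed.

Lemma polyintZ a p : polyint (a *: p) = a * polyint p.
Proof.
rewrite /polyint -RintegralZl//; last exact: integrable_horner.
by apply: eq_Rintegral => x _; rewrite hornerZ.
Qed.

Lemma polyint_sum n (F : 'I_n -> {poly R}) :
  polyint (\sum_(i < n) F i) = \sum_(i < n) polyint (F i).
Proof.
apply: (big_morph polyint polyintD).
by rewrite -(scale0r 0) polyintZ mul0r.
Qed.

Lemma polyint_opolyM m n : polyint (opoly b m * opoly b n) = (m == n)%:R.
Proof.
have [_ <-] := mu_sol.
by apply: eq_Rintegral => x _; rewrite hornerM.
Qed.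

(** In the expansion of x^n, orthonormality keeps only the coefficient of P_k, which is zero when k
    > n. *)
Lemma polyint_XnM_opoly n k : polyint ('X^n * opoly b k) = beta b n k.
Proof.
have [kn|nk] := ltnP k n.+1; last first.
  rewrite beta_gt// (Xn_opolyE b)// mulr_suml polyint_sum big1// => i _.
  rewrite -scalerAl polyintZ polyint_opolyM ltn_eqF ?mulr0//.
  exact: leq_trans (ltn_ord i) nk.
rewrite (Xn_opolyE b)// mulr_suml polyint_sum (bigD1 (Ordinal kn))//=.
rewrite -scalerAl polyintZ polyint_opolyM eqxx mulr1 big1 ?addr0// => i ik.
have /negPf ik' : (i != k :> nat) := ik.
by rewrite -scalerAl polyintZ polyint_opolyM ik' mulr0.
Qed.

Lemma momentE n : moment mu n = polyint 'X^n.
Proof. by apply: eq_Rintegral => x _; rewrite hornerXn. Qed.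

(** As P_0 = 1, the moment is [beta b n 0], which vanishes by parity. *)
Lemma moment_odd n : odd n -> moment mu n = 0.
Proof.
move=> n_odd; rewrite momentE -['X^n]mulr1 -[1]/(opoly b 0).
by rewrite polyint_XnM_opoly beta_odd ?addn0.
Qed.

(** Parseval's identity for x^n: one factor is expanded, the other is integrated against each
    P_k. *)
Lemma moment_double n : moment mu n.*2 = \sum_(k < n.+1) beta b n k ^+ 2.
Proof.
rewrite momentE -addnn exprD {2}(Xn_opolyE b)// mulr_sumr polyint_sum.
by apply: eq_bigr => k _; rewrite -scalerAr polyintZ polyint_XnM_opoly.
Qed.

Lemma U_beta_array n : U b mu n = \sum_(j < n.+1) beta_array b (n - j) j ^+ 2.
Proof.
rewrite /U moment_double -/(bprod b n) prodrXl mulr_suml.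
rewrite [LHS](reindex_inj rev_ord_inj)/=; apply: eq_bigr => j _.
have jn : (j <= n)%N by rewrite -ltnS.
by rewrite subSS /beta_array subnK// expr_div_n.
Qed.

End Moments.

(** * Nonnegative series and the bound on [c] *)

Section EReal.
Context {R : realType}.

Lemma nneseries_le_bound (u : nat -> \bar R) m M : (forall n, (0 <= u n)%E) ->
  (forall n, (\sum_(m <= i < n) u i <= M)%E) ->
  (\sum_(m <= i <oo) u i <= M)%E.
Proof.
move=> u0 uM; apply: lime_le; first exact: is_cvg_nneseries.
by near=> n; exact: uM.
Unshelve. all: by end_near. Qed.

Lemma sum_nat_geometric_le m n (r : R) : 0 <= r < 1 ->
  \sum_(m <= i < n) r ^+ (i - m) <= (1 - r)^-1.
Proof.
move=> r01; rewrite -{1}[m]add0n big_addn big_mkord.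
by under eq_bigr do rewrite addnK; exact: sum_geometric_le.
Qed.

(** The square of c_k b_0 ... b_(k-1) is the sum of the squared entries of column [k], hence at most
    K^2 / (1 - r^2). *)
Lemma c_le (b : nat -> R) K r : (forall n, 0 < b n) -> 0 <= K -> 0 < r < 1 ->
  (forall k j, opoly_array b k j <= K * r ^+ j) ->
  forall k, (c b k <= (K / Num.sqrt (1 - r ^+ 2) / bprod b k)%:E)%E.
Proof.
move=> b0 K0 /andP[r0 r1] HK k.
have P0 := bprod_gt0 b b0 k.
have r2 : 0 <= r ^+ 2 < 1 by rewrite exprn_ge0 ?ltW// expr_lt1 ?ltW.
have s0 : 0 < 1 - r ^+ 2 by rewrite subr_gt0; case/andP: r2.
set B := K / _ / _.
have B0 : 0 <= B by rewrite !divr_ge0// ?sqrtr_ge0// ltW.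
(* Writing the bound as the root of its square reduces the claim to the series under [sqrte]. *)
rewrite -[leRHS]gee0_abs ?lee_fin// -sqrte_sqr /c lee_sqrt; last first.
  by rewrite -EFin_expe lee_fin exprn_ge0.
apply: nneseries_le_bound => n; first by rewrite lee_fin sqr_ge0.
rewrite sumEFin -EFin_expe lee_fin.
have -> : B ^+ 2 = (K / bprod b k) ^+ 2 * (1 - r ^+ 2)^-1.
  by rewrite /B !exprMn !exprVn sqr_sqrtr ?ltW//; ring.
apply: (@le_trans _ _ ((K / bprod b k) ^+ 2 *
                       \sum_(k <= i < n) (r ^+ 2) ^+ (i - k))).
  rewrite mulr_sumr; apply: ler_sum_nat => i /andP[ki _].
  rewrite -exprM mulnC exprM -exprMn -[leLHS]real_normK ?num_real//.
  rewrite lerXn2r ?nnegrE ?mulr_ge0 ?invr_ge0 ?exprn_ge0 ?(ltW P0) ?(ltW r0)//.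
  have := HK k (i - k)%N; rewrite /opoly_array subnKC// => le.
  by rewrite mulrAC ler_pdivlMr// mulrC.
by rewrite ler_wpM2l ?sqr_ge0// sum_nat_geometric_le.
Qed.

End EReal.

(** * Products of [b] and convergence of the series in [cs_star] *)

Section Bounds.
Context {R : realType}.
Variable b : nat -> R.
Hypothesis b_gt0 : forall n, 0 < b n.

Lemma bprodD m n : bprod b (m + n) = bprod b m * \prod_(i < n) b (m + i).
Proof. exact: big_split_ord. Qed.

(* Pairing [b (m + i)] with [b (m + t + i)] for [i < t]. *)
Lemma bprod_sqr_le q C m t :
  (forall k n, (k <= n)%N -> b k / b n <= C * q ^+ (n - k)) ->
  bprod b (m + t) ^+ 2 / bprod b (m + t.*2) <= bprod b m * (C * q ^+ t) ^+ t.
Proof.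
move=> decay.
have Pm := bprod_gt0 b b_gt0 m; have Pt := bprod_gt0 b b_gt0 (m + t).
have -> : bprod b (m + t) ^+ 2 / bprod b (m + t.*2) =
    bprod b m * \prod_(i < t) (b (m + i) / b (m + t + i)).
  rewrite -addnn addnA (bprodD (m + t)) invfM expr2 mulrACA divff ?gt_eqF//.
  by rewrite mul1r bprodD -mulrA -prodfV -big_split.
have -> : (C * q ^+ t) ^+ t = \prod_(i < t) (C * q ^+ t).
  by rewrite prodr_const card_ord.
rewrite ler_pM2l//.
apply: ler_prod => i _; rewrite divr_ge0 ?(ltW (b_gt0 _))//=.
rewrite (le_trans (decay _ _ _))//; first by lia.
by have -> : (m + t + i - (m + i) = t)%N by lia.
Qed.

Lemma moment_double_ge0 (mu : probability (measurableTypeR R) R) n :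
  solves_moment_problem b mu -> 0 <= moment mu n.*2.
Proof.
by move=> sol; rewrite (moment_double b)// sumr_ge0// => i _; exact: sqr_ge0.
Qed.

(** Each summand is at most [w l], which is dominated by a geometric sequence of ratio 1/2. *)
Lemma cs_star_of_bounds (mu : probability (measurableTypeR R) R) q C A M :
  solves_moment_problem b mu -> 0 < q < 1 -> 0 <= A -> 0 <= M ->
  (forall k n, (k <= n)%N -> b k / b n <= C * q ^+ (n - k)) ->
  (forall k, (c b k <= (A / bprod b k)%:E)%E) ->
  (forall n, moment mu n.*2 <= M * bprod b n ^+ 2) ->
  cs_star b mu.
Proof.
move=> sol q01 A0 M0 decay cA sM m.
pose w l := A / bprod b l * `|moment mu (l + m)|.
have P0 n := bprod_gt0 b b_gt0 n.
have [K HK] : exists K, forall l, w l <= K * 2^-1 ^+ l.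
  (* The threshold 1/4 bounds (C q^t)^t by (1/2)^(2t), which matches l = m + 2t. *)
  have [N HN] := @geometric_eventually_le R q C 4^-1 q01 ltac:(by []).
  have [K [K0 HK]] := bounded_prefix (fun l => w l * 2 ^+ l) (m + N.*2).
  (* The factor 2^m compensates for the m in (1/2)^(m+2t). *)
  pose K' := A * M * bprod b m * 2 ^+ m.
  have K'0 : 0 <= K' by rewrite !mulr_ge0// ?exprn_ge0// ltW.
  have half_ge0 l : 0 <= 2^-1 ^+ l :> R by rewrite exprn_ge0.
  exists (K + K') => l.
  have [lN|Nl] := ltnP l (m + N.*2).
    apply: (@le_trans _ _ (K * 2^-1 ^+ l)); last by rewrite ler_wpM2r// lerDl.
    by rewrite exprVn ler_pdivlMr ?exprn_gt0//; exact: HK.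
  apply: (@le_trans _ _ (K' * 2^-1 ^+ l)); last by rewrite ler_wpM2r// lerDr.
  have [lm_odd|lm_even] := boolP (odd (l + m)).
    by rewrite /w (moment_odd b)// normr0 mulr0 mulr_ge0.
  pose t := (l - m)./2.
  have El : l = (m + t.*2)%N by rewrite /t; lia.
  have Elm : (l + m = (m + t).*2)%N by rewrite El; lia.
  have Nt : (N <= t)%N by rewrite /t; lia.
  rewrite /w Elm ger0_norm ?moment_double_ge0// {}El.
  have APl : 0 <= A / bprod b (m + t.*2) by rewrite divr_ge0// ltW.
  apply: (le_trans (ler_wpM2l APl (sM _))).
  have -> : A / bprod b (m + t.*2) * (M * bprod b (m + t) ^+ 2) =
    A * M * (bprod b (m + t) ^+ 2 / bprod b (m + t.*2)) by ring.
  have -> : K' * 2^-1 ^+ (m + t.*2) = A * M * (bprod b m * 4^-1 ^+ t).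
    rewrite /K' exprD -muln2 mulnC exprM (_ : 2^-1 ^+ 2 = 4^-1); last first.
      by rewrite exprVn; congr (_^-1); rewrite expr2; ring.
    by rewrite !exprVn; field; rewrite !expf_neq0.
  rewrite ler_wpM2l ?mulr_ge0//.
  apply: (le_trans (bprod_sqr_le _ _ _ _ decay)).
  (* Taking k = n = 0 in [decay] gives 1 <= C. *)
  have C0 : 0 <= C.
    by have := decay 0%N 0%N isT; rewrite mulr1 divff ?gt_eqF// => /(le_trans _); apply.
  rewrite ler_wpM2l ?(ltW (P0 _))// lerXn2r ?nnegrE ?HN//.
  by rewrite mulr_ge0// exprn_ge0// ltW//; case/andP: q01.
apply: (@le_lt_trans _ _ (K * (1 - 2^-1)^-1)%:E); last exact: ltry.
apply: nneseries_le_bound => [l|n]; first by rewrite mule_ge0// sqrte_ge0.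
apply: (@le_trans _ _ (\sum_(0 <= l < n) (K * 2^-1 ^+ l)%:E)%E).
  apply: lee_sum => l _; apply: (@le_trans _ _ (w l)%:E); last by rewrite lee_fin.
  by rewrite /w EFinM lee_wpmul2r.
rewrite sumEFin lee_fin -mulr_sumr ler_wpM2l//.
  (* Nonnegativity of [K] follows from 0 <= w 0 <= K. *)
  by have := HK 0%N; rewrite mulr1; apply: le_trans; rewrite mulr_ge0// divr_ge0// ltW.
by rewrite big_mkord sum_geometric_le// invr_ge0 ler0n/= invf_lt1// ltr1n.
Qed.

End Bounds.

(** * Assembly of the bounds from the decay of the two arrays *)

Theorem theorem1p9 (R : realType) (b : nat -> R)
    (mu : probability (measurableTypeR R) R)
    (b_gt0 : forall n : nat, 0 < b n)
    (b_qincr : eventually_q_increasing b)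
    (mu_sol : solves_moment_problem b mu) :
  [/\ bounded_fun (U b mu),
      ebounded (V b) &
      ebounded (fun n => c b n * (Num.sqrt (moment mu n.*2))%:E)%E] /\
  cs_star b mu.
Proof.
have [q [C [N [q01 C0 decay ratio_le]]]] := q_increasing_decay b b_gt0 b_qincr.
have [] := array_geometric_bound _ _ _ _ q01
  (opoly_array_recurrence b b_gt0 q C N q01 C0 decay ratio_le).
- by move=> k; rewrite opoly_array0.
- by move=> k; rewrite opoly_array1.
move=> K [r [K0 r01 HK]].
have [] := array_geometric_bound _ _ _ _ q01
  (beta_array_recurrence b b_gt0 q C N q01 C0 decay ratio_le).
- by move=> k; rewrite beta_array0.
- by move=> k; rewrite beta_array1.
move=> K' [r' [K'0 r'01 HK']].
have P0 n := bprod_gt0 b b_gt0 n.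
(* The entries on an antidiagonal are at most K' r'^j, so their squares sum to at most K'^2 / (1 -
   r'^2). *)
have [M [M0 UM]] : exists M, 0 <= M /\ forall n, 0 <= U b mu n <= M.
  have /andP[r'0 r'1] := r'01.
  have r'2 : 0 <= r' ^+ 2 < 1 by rewrite exprn_ge0 ?ltW// expr_lt1 ?ltW.
  exists (K' ^+ 2 * (1 - r' ^+ 2)^-1); split=> [|n].
    by rewrite mulr_ge0 ?sqr_ge0// invr_ge0 subr_ge0 ltW//; case/andP: r'2.
  rewrite (U_beta_array b)//; apply/andP; split.
    by apply: sumr_ge0 => j _; exact: sqr_ge0.
  apply: (@le_trans _ _ (K' ^+ 2 * \sum_(j < n.+1) (r' ^+ 2) ^+ j)).
    rewrite mulr_sumr; apply: ler_sum => j _.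
    rewrite -exprM mulnC exprM -exprMn lerXn2r ?nnegrE//.
      by rewrite divr_ge0 ?beta_ge0// ltW ?bprod_gt0.
    by rewrite mulr_ge0// exprn_ge0// ltW.
  by rewrite ler_wpM2l ?sqr_ge0// sum_geometric_le.
have sM n : moment mu n.*2 <= M * bprod b n ^+ 2.
  have /andP[_] := UM n.
  by rewrite /U prodrXl ler_pdivrMr// exprn_gt0// P0.
pose A := K / Num.sqrt (1 - r ^+ 2).
have A0 : 0 <= A by rewrite divr_ge0// sqrtr_ge0.
have cA := c_le b K r b_gt0 K0 r01 HK; rewrite -/A in cA.
split; last exact: (cs_star_of_bounds b b_gt0 mu q C A M).
split.
- exists M; split; first exact: num_real.
  move=> x Mx n _; have /andP[U0 UMn] := UM n.
  by rewrite /= [leLHS]ger0_norm// (le_trans UMn)// ltW.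
- exists A => n; rewrite gee0_abs; last first.
    by rewrite mule_ge0 ?sqrte_ge0// lee_fin ltW// P0.
  apply: (@le_trans _ _ ((bprod b n)%:E * (A / bprod b n)%:E)%E).
    by apply: lee_wpmul2l; [exact: ltW (P0 n)|exact: cA].
  by rewrite -EFinM lee_fin mulrC divfK// gt_eqF.
(* The products b_0 ... b_(n-1) cancel: c_n is at most [A] divided by the product, and the root of
   s_(2n) at most the root of [M] times it. *)
- exists (A * Num.sqrt M) => n.
  rewrite gee0_abs; last by rewrite mule_ge0 ?sqrte_ge0// lee_fin sqrtr_ge0.
  apply: (@le_trans _ _ ((A / bprod b n)%:E * (Num.sqrt M * bprod b n)%:E)%E).
    apply: lee_pmul; rewrite ?sqrte_ge0 ?lee_fin ?sqrtr_ge0//.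
    rewrite -[X in _ * X](ger0_norm (ltW (P0 n))) -sqrtr_sqr -sqrtrM//.
    exact: ler_wsqrtr.
  by rewrite -EFinM lee_fin mulrACA mulVf ?mulr1// gt_eqF.
Qed.
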